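(* For any element $\mathcal{A}\in U(p,q)$, the matrix $\sqrt{\mathcal{A}^*\mathcal{A}}$ can be expressed uniquely as $e^Y$ with $Y\in\mathfrak{n}$. Moreover, there is a unique way to express $\mathcal{A}$ as a product of a unitary matrix and an element of $e^{\mathfrak{n}}$ (in this order), and it is given by the polar decomposition $$\mathcal{A}=\Big(\mathcal{A}\big(\sqrt{\mathcal{A}^*\mathcal{A}}\big)^{-1}\Big)\sqrt{\mathcal{A}^*\mathcal{A}}.$$
   Context: Let $n=p+q$ and $I_{p,q}=\begin{pmatrix} I_p & 0\\ 0& -I_q\end{pmatrix}$. Then $U(p,q)=\{\mathcal{A}\in GL(n,\mathbb{C}) : \mathcal{A}^*I_{p,q}\mathcal{A}=I_{p,q}\}$, where $^*$ is conjugate transpose. The set $\mathfrak{n}$ is $$\mathfrak{n}=\left\{\begin{pmatrix}0 & B\\ B^* & 0\end{pmatrix} : B\in M_{p,q}(\mathbb{C})\right\},$$ the orthogonal complement of $\mathfrak{u}_p\oplus\mathfrak{u}_q$ (the Lie algebra of $U(p)\times U(q)$) in the Lie algebra $\mathfrak{u}_{p,q}=\{X\in M_n(\mathbb{C}): X^*I_{p,q}+I_{p,q}X=0\}$ with respect to $\langle X,Y\rangle=\mathrm{trace}(X^*Y)$. Also $e^{\mathfrak{n}}=\{e^Y: Y\in\mathfrak{n}\}$, and $\sqrt{\cdot}$ denotes the positive definite square root of a positive definite Hermitian matrix. *)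

(* Defs.v *)
From mathcomp Require Import all_boot all_order all_algebra.
From mathcomp Require Export sesquilinear spectral.
From mathcomp Require Export complex.
From mathcomp Require Import all_classical all_reals all_analysis.

Set Implicit Arguments.
Unset Strict Implicit.
Unset Printing Implicit Defensive.

Import Order.TTheory GRing.Theory Num.Theory.
Import numFieldNormedType.Exports.
Local Open Scope classical_set_scope.
Local Open Scope sesquilinear_scope.
Local Open Scope ring_scope.

(* C is meant to be R[i]. It is kept abstract because the canonical topology on
   a numClosedFieldType is not inferred for the concrete type R[i]. *)
Section Definitions.
Variable C : numClosedFieldType.

(* The limit is taken for the max norm on 'M[C]_n. As [lim] is total, the
   convergence of the series (true for C = R[i]) is left to be proved. *)
Definition expmx n (X : 'M[C]_n) : 'M[C]_n :=
  lim ((fun N => \sum_(0 <= k < N) (k`!%:R)^-1 *: X ^+ k) @ \oo).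

Definition posdefmx n (A : 'M[C]_n) : Prop :=
  A \is hermsymmx /\
  forall x : 'cV[C]_n, x != 0 -> 0 < (x ^t* *m A *m x) 0 0.

(* The default value 0 is returned when A has no positive definite square root;
   existence and uniqueness for positive definite A are left to be proved. *)
Definition sqrtmx n (A : 'M[C]_n) : 'M[C]_n :=
  xget 0 [set S | posdefmx S /\ S *m S = A].

Variables p q : nat.

Definition Ipq : 'M[C]_(p + q) := block_mx 1%:M 0 0 (- 1%:M).

Definition Upq : set 'M[C]_(p + q) :=
  [set A | A \in unitmx /\ A ^t* *m Ipq *m A = Ipq].

Definition npq : set 'M[C]_(p + q) :=
  [set block_mx 0 B (B ^t*) 0 | B in [set: 'M[C]_(p, q)]].

Definition exp_npq : set 'M[C]_(p + q) := [set expmx Y | Y in npq].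

End Definitions.

Arguments Ipq {C p q}.
Arguments Upq {C p q}.
Arguments npq {C p q}.
Arguments exp_npq {C p q}.

(* Main.v *)
Require Import Defs.
From mathcomp Require Import all_boot all_order all_algebra.
From mathcomp Require Import all_classical all_reals all_analysis.

Import Order.TTheory GRing.Theory Num.Theory.
Import numFieldNormedType.Exports.
Local Open Scope classical_set_scope.
Local Open Scope sesquilinear_scope.
Local Open Scope complex_scope.
Local Open Scope ring_scope.

(** Write J for I_{p,q} and H = A^* A, a positive definite matrix. From
    A^* J A = J one gets A J A^* = J, hence H J H = J: conjugation by J turns H
    into its inverse, so it should turn Y := (1/2) log H into - Y, and a
    hermitian matrix that anticommutes with J is exactly an element of n. Then
    e^Y is positive definite with square H, that is, e^Y = sqrt H.

    All functions of matrices (square root, logarithm, exponential) are read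
    off a unitary diagonalization U^* diag(d) U, here [specmx U d]. The lemma
    that replaces a functional calculus is [specmx_intertwine]: if M intertwines
    two such matrices, it still does after applying to both spectra any map
    that respects coincidences of eigenvalues. With M = 1 it yields the
    uniqueness of positive definite square roots ([posdefmx_sqr_inj]) and the
    injectivity of exp on hermitian matrices ([expmx_hermsym_inj]); with M = J it
    passes from J H = H^-1 J to J Y = - Y J ([Upq_gram_exp]).

    For the factorization, let S = sqrt H. Then A S^-1 is unitary because
    S^2 = A^* A. Conversely if A = W P with W unitary and P = e^Z, Z in n, then
    A^* A = P^2 with P positive definite, so P = S and W = A S^-1. *)

(** * Unitarily diagonalized matrices *)

Section SpectralForm.
Set Implicit Arguments.
Unset Strict Implicit.
Variable C : numClosedFieldType.

Definition specmx n (U : 'M[C]_n) (d : 'I_n -> C) : 'M[C]_n :=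
  U^t* *m diag_mx (\row_i d i) *m U.

Lemma adjmxM m n k (A : 'M[C]_(m, n)) (B : 'M[C]_(n, k)) :
  (A *m B)^t* = B^t* *m A^t*.
Proof. by rewrite trmx_mul map_mxM. Qed.

Lemma hermsymmxP n (A : 'M[C]_n) : reflect (A^t* = A) (A \is hermsymmx).
Proof.
apply: (iffP (is_hermitianmxP _ _ _)); rewrite expr0 scale1r.
  by move=> {2}->.
by move->.
Qed.

Lemma unitarymxK n (U : 'M[C]_n) : U \is unitarymx -> U^t* *m U = 1%:M.
Proof. by move=> Uu; rewrite -invmx_unitary// mulVmx ?unitarymx_unit. Qed.

Lemma eq_specmx n (U : 'M[C]_n) a b : a =1 b -> specmx U a = specmx U b.
Proof.
by move=> ab; congr (_ *m diag_mx _ *m _); apply/rowP => i; rewrite !mxE.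
Qed.

Lemma hermsymmx_specmx n (A : 'M[C]_n) : A \is hermsymmx ->
  exists U, exists d,
    [/\ U \is unitarymx, forall i, d i \is Num.real & A = specmx U d].
Proof.
move=> Ah; exists (spectralmx A), (spectral_diag A 0); split.
- exact: spectral_unitarymx.
- by move=> i; apply: (mxOverP (hermitian_spectral_diag_real Ah)).
- have /hermitian_normalmx/orthomx_spectralP {1}-> := Ah.
  rewrite invmx_unitary ?spectral_unitarymx//.
  by congr (_ *m diag_mx _ *m _); apply/rowP => i; rewrite mxE.
Qed.

Lemma specmx_hermsym n (U : 'M[C]_n) d :
  (forall i, d i \is Num.real) -> specmx U d \is hermsymmx.
Proof.
move=> dR; apply/hermsymmxP; rewrite /specmx !adjmxM trmxCK mulmxA.
rewrite tr_diag_mx map_diag_mx; congr (_ *m diag_mx _ *m _).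
by apply/rowP => i; rewrite !mxE; apply/CrealP.
Qed.

Lemma specmxM n (U : 'M[C]_n) a b : U \is unitarymx ->
  specmx U a *m specmx U b = specmx U (fun i => a i * b i).
Proof.
move=> Uu; rewrite /specmx !mulmxA (mulmxtVK _ Uu).
congr (_ *m _); rewrite -mulmxA mulmx_diag; congr (_ *m diag_mx _).
by apply/rowP => i; rewrite !mxE.
Qed.

Lemma specmxN n (U : 'M[C]_n) d : - specmx U d = specmx U (fun i => - d i).
Proof.
rewrite /specmx -mulNmx -mulmxN -raddfN.
by congr (_ *m diag_mx _ *m _); apply/rowP => i; rewrite !mxE.
Qed.

Lemma specmx1 n (U : 'M[C]_n) : U \is unitarymx -> specmx U (fun=> 1) = 1%:M.
Proof.
move=> Uu; rewrite /specmx (_ : \row__ _ = const_mx 1); last first.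
  by apply/rowP => i; rewrite !mxE.
by rewrite diag_const_mx mulmx1 unitarymxK.
Qed.

Lemma specmxV n (U : 'M[C]_n) d : U \is unitarymx -> (forall i, d i != 0) ->
  specmx U (fun i => (d i)^-1) *m specmx U d = 1%:M.
Proof.
move=> Uu d0; rewrite specmxM// -(specmx1 Uu); apply: eq_specmx => i.
by rewrite mulVf.
Qed.

(** From H J H = J to J H = H^-1 J: inverting H inverts its spectrum, so the
    conclusion is an intertwining relation between two spectral forms. *)
Lemma specmx_sandwich n (U J : 'M[C]_n) d :
  U \is unitarymx -> (forall i, d i != 0) ->
  specmx U d *m J *m specmx U d = J ->
  J *m specmx U d = specmx U (fun i => (d i)^-1) *m J.
Proof.
move=> Uu d0 E.
by rewrite -[in RHS]E -(mulmxA _ J) [RHS]mulmxA specmxV// mul1mx.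
Qed.

Lemma specmxX n (U : 'M[C]_n) d k : U \is unitarymx ->
  specmx U d ^+ k = specmx U (fun i => d i ^+ k).
Proof.
move=> Uu; elim: k => [|k IHk].
  by rewrite expr0 specmx1.
rewrite exprS IHk [LHS]specmxM//.
by apply: eq_specmx => i; rewrite exprS.
Qed.

Lemma specmxE n (U : 'M[C]_n) d i j :
  specmx U d i j = \sum_k (U k i)^* * d k * U k j.
Proof.
rewrite mxE; apply: eq_bigr => k _; congr (_ * _).
by rewrite mul_mx_diag !mxE.
Qed.

(** Conjugating M to W = V M U^*, the intertwining relation says that
    W i j * a j = b i * W i j for all i and j, so W i j = 0 unless a j = b i;
    only these coincidences of eigenvalues matter. *)
Lemma specmx_intertwine n (U V M : 'M[C]_n) a b a' b' :
  U \is unitarymx -> V \is unitarymx ->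
  (forall i j, a j = b i -> a' j = b' i) ->
  M *m specmx U a = specmx V b *m M -> M *m specmx U a' = specmx V b' *m M.
Proof.
move=> Uu Vu ab MUV.
pose W := V *m M *m U^t*.
have WE c c' : (M *m specmx U c = specmx V c' *m M) <->
    forall i j, W i j * c j = c' i * W i j.
  have -> : (M *m specmx U c = specmx V c' *m M) <->
      (W *m diag_mx (\row_i c i) = diag_mx (\row_i c' i) *m W).
    rewrite /specmx /W; split=> [E|E].
      have := congr1 (fun X => V *m X *m U^t*) E.
      by rewrite !mulmxA (mulmxtVK _ Uu) (unitarymxP _) ?mul1mx.
    have := congr1 (fun X => V^t* *m X *m U) E.
    by rewrite !mulmxA unitarymxK ?mul1mx// (mulmxKtV _ Uu).
  rewrite mul_mx_diag mul_diag_mx; split=> [/matrixP E i j|E].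
    by have := E i j; rewrite !mxE.
  by apply/matrixP => i j; have := E i j; rewrite !mxE.
apply/WE => i j; have /WE/(_ i j) := MUV.
rewrite mulrC => /eqP; rewrite -subr_eq0 -mulrBl mulf_eq0 subr_eq0.
by case/orP => /eqP E; [rewrite (ab i j E) mulrC | rewrite E mulr0 mul0r].
Qed.

Lemma eq_specmx_transfer n (U V : 'M[C]_n) a b a' b' :
  U \is unitarymx -> V \is unitarymx ->
  (forall i j, a j = b i -> a' j = b' i) ->
  specmx U a = specmx V b -> specmx U a' = specmx V b'.
Proof.
move=> Uu Vu ab E; have := @specmx_intertwine _ U V 1%:M _ _ _ _ Uu Vu ab.
by rewrite !mul1mx !mulmx1; apply.
Qed.

Lemma specmx_form n (U : 'M[C]_n) d (x : 'cV[C]_n) :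
  (x^t* *m specmx U d *m x) 0 0 = \sum_i d i * `|(U *m x) i 0| ^+ 2.
Proof.
rewrite /specmx !mulmxA -adjmxM -mulmxA mxE; apply: eq_bigr => i _.
by rewrite mul_mx_diag !mxE mulrAC mulrC normCK; congr (_ * _); rewrite mulrC.
Qed.

Lemma specmx_posdef n (U : 'M[C]_n) d :
  U \is unitarymx -> (forall i, 0 < d i) -> posdefmx (specmx U d).
Proof.
move=> Uu d0; split; first by apply: specmx_hermsym => i; apply: gtr0_real.
move=> x x0; rewrite specmx_form lt0r; apply/andP; split; last first.
  by apply: sumr_ge0 => i _; rewrite mulr_ge0 ?exprn_ge0// ltW.
apply: contraNneq x0 => /eqP; rewrite psumr_eq0 => [/allP s0|i _]; last first.
  by rewrite mulr_ge0 ?exprn_ge0// ltW.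
have Ux0 : U *m x = 0.
  apply/colP => i; rewrite [RHS]mxE; apply/eqP.
  have := s0 i (mem_index_enum _).
  by rewrite mulf_eq0 gt_eqF//= sqrf_eq0 normr_eq0.
by rewrite -[x]mul1mx -(unitarymxK Uu) -mulmxA Ux0 mulmx0.
Qed.

(** The eigenvalue d i is the value of the quadratic form at the unit vector
    U^* e_i. *)
Lemma posdefmx_specmx n (A : 'M[C]_n) : posdefmx A ->
  exists U, exists d, [/\ U \is unitarymx, forall i, 0 < d i & A = specmx U d].
Proof.
case=> /hermsymmx_specmx [U [d [Uu _ ->]]] pos; exists U, d; split=> // i.
pose x : 'cV[C]_n := U^t* *m delta_mx i 0.
have UxE : U *m x = delta_mx i 0.
  by rewrite mulmxA (unitarymxP _) ?mul1mx.
have x0 : x != 0.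
  apply: contra_eq_neq UxE => ->; rewrite mulmx0 eq_sym.
  by apply/negP => /eqP/matrixP/(_ i 0)/eqP; rewrite !mxE !eqxx oner_eq0.
have := pos x x0; rewrite specmx_form (bigD1 i)//= big1 => [|j ji].
  by rewrite UxE mxE !eqxx normr1 expr1n mulr1 addr0.
by rewrite UxE mxE (negPf ji) normr0 expr0n mulr0.
Qed.

(** * Positive definite square roots and polar factors *)

(** Squaring is injective on positive eigenvalues, so a diagonalization of S^2
    determines S by spectral transfer. *)
Lemma posdefmx_sqr_inj n (S T : 'M[C]_n) :
  posdefmx S -> posdefmx T -> S *m S = T *m T -> S = T.
Proof.
move=> /posdefmx_specmx[U [a [Uu a0 ->]]] /posdefmx_specmx[V [b [Vu b0 ->]]].
rewrite !specmxM//; apply: eq_specmx_transfer => // i j ab.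
by apply/eqP; rewrite -(eqrXn2 (n := 2)) ?ltW// !expr2 ab.
Qed.

Lemma sqrtmx_sqr n (S : 'M[C]_n) : posdefmx S -> sqrtmx (S *m S) = S.
Proof.
move=> Sp; rewrite /sqrtmx; case: xgetP => [T _ [Tp TS]|/(_ S) []//].
exact: posdefmx_sqr_inj.
Qed.

Lemma posdefmx_unit n (S : 'M[C]_n) : posdefmx S -> S \in unitmx.
Proof.
case/posdefmx_specmx => U [d [Uu d0 ->]].
by have [|_ ->//] := mulmx1_unit (@specmxV _ _ d Uu _) => // i; rewrite gt_eqF.
Qed.

(** This forces the positive factor of any polar decomposition W P. *)
Lemma sqrtmx_gram_mul n (W P : 'M[C]_n) : W \is unitarymx -> posdefmx P ->
  sqrtmx ((W *m P)^t* *m (W *m P)) = P.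
Proof.
move=> Wu Pp; have [/hermsymmxP Ph _] := Pp.
rewrite adjmxM Ph mulmxA -(mulmxA P) (unitarymxK Wu) mulmx1.
exact: sqrtmx_sqr.
Qed.

Lemma unitarymx_mul_invmx n (A S : 'M[C]_n) :
  posdefmx S -> S *m S = A^t* *m A -> A *m invmx S \is unitarymx.
Proof.
move=> Sp SE; have Su := posdefmx_unit Sp; have [/hermsymmxP Sh _] := Sp.
have VS : (invmx S)^t* *m S = 1%:M.
  by rewrite -[X in _ *m X]Sh -adjmxM mulmxV// trmx1 map_mx1.
rewrite -trmxC_unitary; apply/unitarymxP; rewrite trmxCK adjmxM.
by rewrite mulmxA -[_ *m A^t* *m A]mulmxA -SE mulmxA VS mul1mx mulmxV.
Qed.

(** * The exponential of a diagonalized matrix *)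

Lemma cvg_mx_entrywise m n (F : nat -> 'M[C]_(m, n)) (L : 'M[C]_(m, n)) :
  (forall i j, (fun N => F N i j) @ \oo --> L i j) -> F @ \oo --> L.
Proof.
move=> FL; apply/cvg_ballP => e e0.
suff: \forall N \near \oo, forall i j, ball (L i j) e (F N i j).
  by apply: filterS => N FN; split.
apply: filter_forall => i; apply: filter_forall => j.
by have /cvg_ballP/(_ e e0) := FL i j.
Qed.

(** The entries of the partial sums are fixed linear combinations of the scalar
    partial sums at the eigenvalues. The scalar convergence is written with
    moduli, so that on R[i] it reduces to a statement about real numbers. *)
Lemma expmx_specmx n (U : 'M[C]_n) d e : U \is unitarymx ->
  (forall i eps, 0 < eps -> \forall N \near \oo,
     `|e i - \sum_(0 <= k < N) (k`!%:R)^-1 * d i ^+ k| < eps) ->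
  expmx (specmx U d) = specmx U e.
Proof.
move=> Uu de; apply: cvg_lim; first exact: norm_hausdorff.
apply: cvg_mx_entrywise => i j; rewrite specmxE.
rewrite (_ : (fun N => _) = fun N => \sum_l (U l i)^* *
    (\sum_(0 <= k < N) (k`!%:R)^-1 * d l ^+ k) * U l j); last first.
  apply/funext => N; rewrite summxE.
  under eq_bigr do rewrite mxE specmxX// specmxE mulr_sumr.
  rewrite exchange_big/=; apply: eq_bigr => l _.
  rewrite mulr_sumr mulr_suml; apply: eq_bigr => k _.
  by rewrite !mulrA [_ * (U l i)^*]mulrC.
apply: cvg_big => [|l _]; first exact: add_continuous.
apply: cvgMr_tmp; apply: cvgMl_tmp; apply/cvgrPdist_lt => eps eps0.
exact: de.
Qed.

End SpectralForm.

(** * Exponentials of complex hermitian matrices *)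

Section RealSpectrum.
Set Implicit Arguments.
Unset Strict Implicit.
Variable R : realType.

Lemma cvg_exp_complex (x : R) (eps : R[i]) : 0 < eps -> \forall N \near \oo,
  `|(expR x)%:C - \sum_(0 <= k < N) (k`!%:R)^-1 * x%:C ^+ k| < eps.
Proof.
move=> eps0; have /complex_realP[r rE] := gtr0_real eps0.
rewrite {}rE in eps0 *; rewrite (ltcR 0) in eps0.
have /cvgrPdist_lt/(_ r eps0) := is_cvg_series_exp_coeff x.
apply: filterS => N dist_lt.
rewrite (_ : \sum_(_ <= _ < _) _ =
  (series (exp_coeff x) N)%:C); last first.
  rewrite /series/= rmorph_sum; apply: eq_bigr => k _.
  by rewrite mulrC rmorphM fmorphV rmorph_nat rmorphXn.
rewrite -rmorphB normc_def ltcR expr0n addr0 sqrtr_sqr.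
exact: dist_lt.
Qed.

Lemma expmx_specmx_real n (U : 'M[R[i]]_n) (y : 'I_n -> R) :
  U \is unitarymx ->
  expmx (specmx U (fun i => (y i)%:C)) = specmx U (fun i => (expR (y i))%:C).
Proof. by move=> Uu; apply: expmx_specmx => // i eps; apply: cvg_exp_complex. Qed.

Lemma hermsymmx_specmx_real n (Y : 'M[R[i]]_n) : Y \is hermsymmx ->
  exists U, exists y : 'I_n -> R,
    U \is unitarymx /\ Y = specmx U (fun i => (y i)%:C).
Proof.
move=> /hermsymmx_specmx[U [d [Uu dR ->]]]; exists U, (fun i => complex.Re (d i)).
by split; [exact: Uu | apply: eq_specmx => i; rewrite (RRe_real (dR i))].
Qed.

Lemma posdefmx_expmx n (Y : 'M[R[i]]_n) : Y \is hermsymmx -> posdefmx (expmx Y).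
Proof.
move=> /hermsymmx_specmx_real[U [y [Uu ->]]]; rewrite expmx_specmx_real//.
by apply: specmx_posdef => // i; rewrite (ltcR 0) expR_gt0.
Qed.

(** The eigenvalues are real, and the real exponential is injective. *)
Lemma expmx_hermsym_inj n (Y Z : 'M[R[i]]_n) :
  Y \is hermsymmx -> Z \is hermsymmx -> expmx Y = expmx Z -> Y = Z.
Proof.
move=> /hermsymmx_specmx_real[U [y [Uu ->]]].
move=> /hermsymmx_specmx_real[V [z [Vu ->]]].
rewrite (expmx_specmx_real _ Uu) (expmx_specmx_real _ Vu).
by apply: (eq_specmx_transfer Uu Vu) => i j /complexI/expR_inj ->.
Qed.

End RealSpectrum.

(** * The group U(p,q) and the space n *)

Section IndefiniteUnitary.
Set Implicit Arguments.
Unset Strict Implicit.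
Variable C : numClosedFieldType.
Variables p q : nat.
Implicit Types A Y : 'M[C]_(p + q).

Lemma IpqK : Ipq *m Ipq = 1%:M :> 'M[C]_(p + q).
Proof.
rewrite /Ipq mulmx_block !(mulmx0, mul0mx, mul1mx, mulmxN, addr0, add0r).
by rewrite mulmx1 opprK -scalar_mx_block.
Qed.

(** Anticommuting with J kills the two diagonal blocks and leaves the others
    free; being hermitian then makes these adjoint to each other. *)
Lemma npqP Y : npq Y <-> Y \is hermsymmx /\ Ipq *m Y = - Y *m Ipq.
Proof.
have symE (a : 'M[C]_p) b c (d : 'M[C]_q) : Ipq *m block_mx a b c d =
    - block_mx a b c d *m Ipq <-> a = 0 /\ d = 0.
  rewrite /Ipq opp_block_mx !mulmx_block.
  rewrite !(mulmx0, mul0mx, mul1mx, mulmx1, addr0, add0r, mulmxN, mulNmx, opprK).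
  split=> [/eq_block_mx[aE _ _ dE]|[-> ->]]; last by rewrite !oppr0.
  have opp0 m (M : 'M[C]_m) : M = - M -> M = 0.
    move=> /eqP; rewrite -addr_eq0 -mulr2n -scaler_nat scaler_eq0 pnatr_eq0/=.
    by move/eqP.
  by split; apply: opp0 => //; rewrite dE.
have adjE (a : 'M[C]_p) b c (d : 'M[C]_q) :
    (block_mx a b c d)^t* = block_mx (a^t*) (c^t*) (b^t*) (d^t*).
  by rewrite tr_block_mx map_block_mx.
rewrite /npq; split=> [[B _ <-]|[/hermsymmxP Yh]].
  split; last by apply/symE.
  by apply/hermsymmxP; rewrite adjE !trmx0 !map_mx0 trmxCK.
move: Yh; rewrite -(submxK Y) adjE => /eq_block_mx[_ _ cE _] /symE[-> ->].
by exists (ursubmx Y); rewrite ?cE.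
Qed.

(** U(p,q) is stable under adjunction: J A^* J is a left inverse of A, hence also
    a right inverse. *)
Lemma Upq_adj A : Upq A -> A *m Ipq *m A^t* = Ipq.
Proof.
case=> _ AJA; have AL : (Ipq *m A^t* *m Ipq) *m A = 1%:M.
  by rewrite -!mulmxA [_ *m (_ *m A)]mulmxA AJA IpqK.
have /(congr1 (mulmx^~ Ipq)) := mulmx1C AL.
by rewrite mul1mx !mulmxA -[_ *m Ipq *m Ipq]mulmxA IpqK mulmx1.
Qed.

(** The two relations A J A^* = J and A^* J A = J are used in turn, from the
    inside out. *)
Lemma Upq_gram A : Upq A -> (A^t* *m A) *m Ipq *m (A^t* *m A) = Ipq.
Proof.
move=> UA; have [_ AJA] := UA.
by rewrite -!mulmxA [A *m (Ipq *m _)]mulmxA [_ *m (A^t* *m A)]mulmxA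
  Upq_adj// mulmxA.
Qed.

End IndefiniteUnitary.

(** * The logarithm of the polar part *)

Section Polar.
Set Implicit Arguments.
Unset Strict Implicit.

Lemma gram_posdef (C : numClosedFieldType) n (A : 'M[C]_n) :
  A \in unitmx -> posdefmx (A^t* *m A).
Proof.
move=> Au; split; first by apply/hermsymmxP; rewrite adjmxM trmxCK.
move=> x x0; rewrite mulmxA -adjmxM -mulmxA.
have Ax0 : A *m x != 0.
  by apply: contraNneq x0 => E; rewrite -[x](mulKmx Au) E mulmx0.
rewrite lt0r mxE; under eq_bigr do rewrite !mxE mulrC -normCK.
rewrite sumr_ge0 ?andbT => [|i _]; last by rewrite exprn_ge0.
apply: contraNneq Ax0 => /eqP; rewrite psumr_eq0 => [/allP s0|i _].
  apply/eqP/colP => i; rewrite [RHS]mxE; apply/eqP.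
  by have := s0 i (mem_index_enum _); rewrite /= sqrf_eq0 normr_eq0 mxE.
by rewrite exprn_ge0.
Qed.

(** Y is half the logarithm of A^* A. It anticommutes with J since an eigenvalue
    equation r j = (r i)^-1 gives ln (r j) = - ln (r i). *)
Lemma Upq_gram_exp (R : realType) p q (A : 'M[R[i]]_(p + q)) : Upq A ->
  exists2 Y, npq Y & expmx Y *m expmx Y = A^t* *m A.
Proof.
move=> UA; have [Au _] := UA.
have [U [h [Uu h0 HE]]] := posdefmx_specmx (gram_posdef Au).
have [r rE] : exists r : 'I_(p + q) -> R, forall i, h i = (r i)%:C.
  exists (fun i => complex.Re (h i)) => i.
  by rewrite (RRe_real (gtr0_real (h0 i))).
have r0 i : 0 < r i by have := h0 i; rewrite rE (ltcR 0).
pose y i := ln (r i) / 2.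
have yE i : expR (y i) * expR (y i) = r i.
  by rewrite -expRD /y -splitr lnK// posrE.
exists (specmx U (fun i => (y i)%:C)); last first.
  rewrite (expmx_specmx_real _ Uu) (specmxM _ _ Uu) HE; apply: eq_specmx => i.
  by rewrite rE -yE rmorphM.
apply/npqP; split.
  by apply: specmx_hermsym => i; apply/complex_realP; exists (y i).
rewrite specmxN.
apply: (specmx_intertwine Uu Uu (a := h) (b := fun i => (h i)^-1)).
  move=> i j; rewrite !rE -fmorphV => /complexI rji.
  by rewrite -rmorphN /y rji lnV ?posrE// mulNr.
apply: specmx_sandwich => // [i|]; first by rewrite gt_eqF.
by rewrite -HE; apply: Upq_gram.
Qed.

End Polar.

Theorem theorem4p6 (R : realType) (p q : nat) (A : 'M[R[i]]_(p + q))
    (hA : Upq A) :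
  (exists! Y : 'M[R[i]]_(p + q), npq Y /\ sqrtmx (A ^t* *m A) = expmx Y) /\
  unique
    (fun UP : 'M[R[i]]_(p + q) * 'M[R[i]]_(p + q) =>
       [/\ UP.1 \is unitarymx, exp_npq UP.2 & A = UP.1 *m UP.2])
    (A *m invmx (sqrtmx (A ^t* *m A)), sqrtmx (A ^t* *m A)).
Proof.
have [Y nY YE] := Upq_gram_exp hA.
have expP (Z : 'M[R[i]]_(p + q)) : npq Z -> posdefmx (expmx Z).
  by case/npqP => Zh _; apply: posdefmx_expmx.
have SE : sqrtmx (A^t* *m A) = expmx Y by rewrite -YE sqrtmx_sqr//; apply: expP.
have Su : expmx Y \in unitmx by apply/posdefmx_unit/expP.
rewrite SE; split.
  exists Y; split=> [|Z [nZ]]; first by split.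
  by apply: expmx_hermsym_inj; [case/npqP: nY|case/npqP: nZ].
split=> /=.
  split; [|by exists Y|by rewrite mulmxKV].
  by apply: unitarymx_mul_invmx; [exact: expP | exact: YE].
case=> W P /= [Wu [Z nZ <-] AE].
have PE : expmx Z = expmx Y.
  by rewrite -SE AE; apply/esym/sqrtmx_gram_mul; [exact: Wu | exact: expP].
by rewrite PE AE PE mulmxK.
Qed.
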